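(* For all $k,\ell\in\mathbb{N}$, every graph $G$ and every set $\mathcal{A}\subseteq V(G)$, at least one of the following holds: (i) $G$ contains $k$ pairwise anti-complete induced $\mathcal{A}$-paths, each of length at least $\ell$; or (ii) there exist sets $Z_1,Z_2\subseteq V(G)$ with $|Z_1|\leq (12\max\{\ell,3\}+18)(k-1)$ and $|Z_2|\leq 4(k-1)$ such that neither $G-N_G[Z_1]$ nor $G-N_G[Z_2,\max\{\ell+1,4\}]$ contains an induced $\mathcal{A}$-path of length at least $\ell$.
   Context: $\mathbb{N}=\{1,2,\dots\}$. Graphs are finite, simple and undirected. For a graph $G$ and $\mathcal{A}\subseteq V(G)$, an $\mathcal{A}$-path in $G$ is a path in $G$ with at least one edge whose two endpoints belong to $\mathcal{A}$ (internal vertices may also belong to $\mathcal{A}$). An induced path of $G$ is a path that is an induced subgraph of $G$; an induced $\mathcal{A}$-path is an $\mathcal{A}$-path that is an induced path. The length of a path is its number of edges. Two sets $X,Y\subseteq V(G)$ are anti-complete if $X\cap Y=\emptyset$ and there is no edge of $G$ with one end in $X$ and the other in $Y$; two paths in $G$ are anti-complete if their vertex sets are. For $Z\subseteq V(G)$ and $r\in\mathbb{N}$, $N_G[Z,r]$ is the set of vertices of $G$ at distance at most $r$ in $G$ from some vertex of $Z$, and $N_G[Z]:=N_G[Z,1]$. For $S\subseteq V(G)$, $G-S$ is the subgraph of $G$ induced by $V(G)\setminus S$; an $\mathcal{A}$-path of $G-S$ is an $\mathcal{A}$-path of $G$ all of whose vertices avoid $S$. *)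

(* Defs.v *)
From mathcomp Require Import all_boot.

Set Implicit Arguments.
Unset Strict Implicit.
Unset Printing Implicit Defensive.

(* Finite simple graphs are symmetric irreflexive relations [e : rel T] on a
   finite type [T] of vertices.  A path is given by the sequence of its vertices
   in order (one of its two orientations); it has at least one vertex. *)

Section Graph.

Variables (T : finType) (e : rel T).
Implicit Types (s : seq T) (A S X Y Z : {set T}) (u v : T) (r : nat).

Definition is_path s : bool :=
  if s is x :: p then path e x p && uniq s else false.

Definition path_length s : nat := (size s).-1.

Definition path_edge s : rel T :=
  [rel u v | infix [:: u; v] s || infix [:: v; u] s].

(* The edges of the graph between vertices of the path are exactly the edges of
   the path, i.e., the path is the subgraph induced by its vertex set. *)
Definition induced_path s : Prop :=
  is_path s /\ {in s &, forall u v, e u v = path_edge s u v}.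

Definition ends_in A s : bool :=
  if s is x :: p then (x \in A) && (last x p \in A) else false.

Definition Apath A s : Prop :=
  [/\ is_path s, 0 < path_length s & ends_in A s].

Definition induced_Apath A s : Prop := Apath A s /\ induced_path s.

Definition anticomplete X Y : Prop :=
  [disjoint X & Y] /\ {in X & Y, forall u v, ~~ e u v}.

(* The distance from [u] to [v], the least length of a path from [u] to [v]
   (infinite if there is none), is at most [r]. *)
Definition dist_le r u v : bool :=
  [exists n : 'I_r.+1, exists p : n.-tuple T,
     is_path (u :: p) && (last u p == v)].

Definition ball Z r : {set T} := [set v | [exists z in Z, dist_le r z v]].

(* An induced A-path of G - S is an induced A-path of G whose vertices all
   avoid S, since G - S is an induced subgraph of G. *)
Definition induced_Apath_minus A S s : Prop :=
  induced_Apath A s /\ {in s, forall v, v \notin S}.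

End Graph.

Definition closed_nbhd (T : finType) (e : rel T) (Z : {set T}) : {set T} :=
  ball e Z 1.

(* Main.v *)
Require Import Defs.
From mathcomp Require Import all_boot zify.
From Stdlib Require Import Classical_Prop Btauto.

(** Put [L = max (l, 3)], and call a path long if its length is at least [l].
A leg is an induced path [q, ..., a] ending in [A]; a forest is a sequence of
legs in which each new leg is a long [A]-path, or hangs from an older leg [Q]:
only [q] has neighbours in older legs, and all of them lie on [Q], within
distance 2 of one another along [Q], and at distance at least [L] along [Q]
from the two ends of [Q] and from the neighbours of the other legs hanging
from [Q]. Two facts carry the proof.

Packing ([forest_packing]). A forest with [m] legs contains at least [m / 2],
rounded up, pairwise anti-complete long induced [A]-paths. If no leg hangs
from another, the legs themselves are such paths. Otherwise let [Q] be the
newest leg from which other legs hang; nothing hangs from those. Walking down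
[Q] towards its end in [A], let [d] be the leg met last. The path from the end
of [d] to its start and on to the end of [Q] is an induced [A]-path,
anti-complete to all other legs and to the part of [Q] above. Output it and
delete [d]. If another leg hangs from [Q], the lowest of them, [d2], takes
over the role of the lost lower part of [Q]; otherwise [Q] is deleted too.
Either way two legs were spent on one path.

Covering ([forest_extend], [maximal_guarded]). Build the forest greedily, each
new leg being as short as possible. Let the guard consist of the vertices
within distance [L] of a leg end, or less than [L] from a junction, measured
along the legs. It has at most [6 L + 9] vertices per leg, all within distance
[L] of the first or last vertex of some leg. Suppose that [s] is a candidate
leg whose start [q] has neighbours in the forest, none in the guard. Then [s]
can be added. Indeed, let [Q] be a leg on which [q] has a neighbour. If [q]
has neighbours on an older leg too, with [s] a possible leg there, then [q]
followed by the lower part of [Q] could have been chosen instead of [Q], and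
is shorter. If [q] has two neighbours on [Q] at distance at least 3, then the
detour through [q] shortens [Q]. So the neighbours of [q] lie close together
on a single leg. Hence if the forest is maximal, every long induced [A]-path
has a vertex in the closed neighbourhood of the guard: otherwise its initial
segment up to the first contact with the forest, or all of it if there is no
contact, would be a new leg.

Now build greedily up to [2 k - 1] legs. If this succeeds, packing gives [k]
paths. If not, the forest is maximal with at most [2 (k - 1)] legs; the guard
serves as [Z1], and the first and last vertices of the legs serve as [Z2]. *)

Set Implicit Arguments.
Unset Strict Implicit.
Unset Printing Implicit Defensive.

(** * Chordless vertex sequences *)

Section Chordless.

Variables (T : finType) (e : rel T).
Hypotheses (e_sym : symmetric e) (e_irr : irreflexive e).
Implicit Types (s t p : seq T) (u v w x y q : T).

Definition apart : rel T := [rel x y | (x != y) && ~~ e x y].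

Lemma apartC x y : apart x y = apart y x.
Proof. by rewrite /apart /= [x == y]eq_sym e_sym. Qed.

Definition separated s t := allrel apart s t.

Lemma separatedC s t : separated s t = separated t s.
Proof.
by rewrite /separated allrelC; apply: eq_allrel => x y; rewrite -/(apart x y) apartC.
Qed.

Lemma separatedP s t :
  reflect {in s & t, forall x y, apart x y} (separated s t).
Proof. exact: allrelP. Qed.

Lemma separatedS s s' t t' :
  {subset s <= s'} -> {subset t <= t'} -> separated s' t' -> separated s t.
Proof.
by move=> ss tt /separatedP h; apply/separatedP => x y /ss xs /tt yt; apply: h.
Qed.

(** Induced paths, in a form that can be taken apart and glued together:
consecutive vertices are adjacent, all others are distinct and nonadjacent. *)
Fixpoint chordless s :=
  if s is x :: p then
    (if p is y :: p' then e x y && all (apart x) p' else true) && chordless p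
  else true.

Lemma chordless_cons2 x y p :
  chordless [:: x, y & p] = [&& e x y, all (apart x) p & chordless (y :: p)].
Proof. by rewrite /= -!andbA. Qed.

(** The only edge between the two parts is the one that links them; every
gluing and cutting of paths below goes through this equation. *)
Lemma chordless_cat s x y t :
  chordless (rcons s x ++ y :: t) =
  [&& chordless (rcons s x), chordless (y :: t), e x y,
      separated s (y :: t) & all (apart x) t].
Proof.
elim: s => [|a [|b s] IH].
- rewrite [LHS]chordless_cons2 /separated allrel0l /=; btauto.
- have -> : rcons [:: a] x ++ y :: t = [:: a, x, y & t] by [].
  rewrite !chordless_cons2 /separated !allrel_consl !allrel0l /=; btauto.
have -> : rcons [:: a, b & s] x ++ y :: t = [:: a, b & rcons s x ++ y :: t] by [].
rewrite chordless_cons2 [chordless (b :: _)]IH !rcons_cons.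
rewrite [chordless [:: a, b & _]]chordless_cons2 all_cat all_rcons /separated.
rewrite [allrel _ [:: a, b & s] _]allrel_consl /=; btauto.
Qed.

Lemma chordless_uniq s : chordless s -> uniq s.
Proof.
elim: s => [|x [|y p] IH] //; rewrite chordless_cons2 => /and3P[exy /allP xp cp].
rewrite cons_uniq IH // andbT inE negb_or; apply/andP; split.
  by apply: contraTneq exy => ->; rewrite e_irr.
by apply/negP => /xp; rewrite /apart /= eqxx.
Qed.

Lemma chordless_catr s t : chordless (s ++ t) -> chordless t.
Proof. by elim: s => // a s IH /= /andP[_ /IH]. Qed.

Lemma chordless_catl s t : chordless (s ++ t) -> chordless s.
Proof.
case: t => [|y t]; first by rewrite cats0.
by case/lastP: s => // s x; rewrite chordless_cat => /and5P[].
Qed.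

Lemma chordless_separated s x t : chordless (s ++ x :: t) -> separated s t.
Proof.
case/lastP: s => [|s y]; first by rewrite /separated allrel0l.
rewrite chordless_cat => /and5P[_ _ _ /separatedP sx yt].
apply/separatedP => u v; rewrite mem_rcons inE => /predU1P[-> vt|us vt].
  exact: (allP yt).
by apply: sx; rewrite ?inE ?vt ?orbT.
Qed.

Lemma chordless_rev s : chordless (rev s) = chordless s.
Proof.
elim: s => // x [|y p] IH //.
rewrite !rev_cons -[rcons (rcons _ y) x]cats1 chordless_cat -rev_cons IH.
rewrite chordless_cons2 /separated allrel1r all_rev andbT e_sym /=.
rewrite (eq_all (a2 := apart x)); first by btauto.
by move=> z; rewrite apartC.
Qed.

Lemma chordless_path x p : chordless (x :: p) -> path e x p.
Proof.
elim: p x => // y p IH x; rewrite chordless_cons2 => /and3P[exy _ /IH pp].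
by rewrite /= exy pp.
Qed.

Lemma path_edgeE s u v :
  path_edge s u v = infix [:: u; v] s || infix [:: v; u] s.
Proof. by []. Qed.

Lemma path_edge_cons x y p u v : x \notin y :: p -> u \in y :: p -> v \in y :: p ->
  path_edge [:: x, y & p] u v = path_edge (y :: p) u v.
Proof.
move=> xp up vp; have nx w : w \in y :: p -> (w == x) = false.
  by move=> wp; apply: contraNF xp => /eqP <-.
by rewrite !path_edgeE !(infix_consl _ x) !prefix_cons !nx.
Qed.

Lemma path_edge_head x y p v : x \notin y :: p -> v \in y :: p ->
  path_edge [:: x, y & p] x v = (v == y) /\ path_edge [:: x, y & p] v x = (v == y).
Proof.
move=> xp vp; have xv : (v == x) = false by apply: contraNF xp => /eqP <-.
have ni w : infix [:: x; w] (y :: p) = false /\ infix [:: w; x] (y :: p) = false.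
  split; apply: contraNF xp => /infixP [s [s' ->]].
    by rewrite !mem_cat !inE eqxx !orbT.
  by rewrite !mem_cat !inE eqxx !orbT.
rewrite !path_edgeE !(infix_consl _ x) !prefix_cons !(ni v).1 !(ni v).2 xv eqxx.
by rewrite prefix0s /= andbT !orbF.
Qed.

Lemma induced_pathP s : induced_path e s <-> s != [::] /\ chordless s.
Proof.
split=> [[]|[]].
  case: s => // x p; rewrite /is_path => /andP[pp up] ed; split=> //.
  elim: p x pp up ed => // y p IH x; rewrite chordless_cons2.
  rewrite [path _ _ _]/= => /andP[exy pp]; rewrite cons_uniq => /andP[xp up] ed.
  rewrite exy /=; apply/andP; split.
    apply/allP => z zp; rewrite /apart /=; apply/andP; split.
      by apply: contraNneq xp => ->; rewrite inE zp orbT.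
    have zp' : z \in y :: p by rewrite inE zp orbT.
    rewrite ed ?inE ?eqxx ?zp ?orbT // (path_edge_head xp zp').1.
    by case/andP: up => yp _; apply: contraNneq yp => <-.
  apply: IH => // u v uy vy.
  by rewrite ed ?(path_edge_cons xp) // ?[_ \in x :: _]inE ?uy ?vy ?orbT.
case: s => // x p _ cp; split.
  by rewrite /is_path chordless_path //= -/(uniq (x :: p)) chordless_uniq.
elim: p x cp => [|y p IH] x.
  by move=> _ u v; rewrite !inE => /eqP-> /eqP->; rewrite e_irr /path_edge /= eqxx andbF.
move=> cp; have:= chordless_uniq cp; rewrite cons_uniq => /andP[xp up].
move: cp; rewrite chordless_cons2 => /and3P[exy xap cp].
have hx v : v \in y :: p -> e x v = (v == y).
  rewrite inE; case: eqP => [->|_] //= vp.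
  by have /andP[_ /negbTE] := allP xap v vp.
have xx w : infix [:: w; w] [:: x, y & p] -> False.
  move=> /infixP [s [s' E]]; have: uniq [:: x, y & p] by rewrite cons_uniq xp.
  by rewrite E !cat_uniq /= inE eqxx /= !andbF.
move=> u v; rewrite inE => /predU1P[->|uy]; rewrite inE => /predU1P[->|vy].
- by rewrite e_irr; symmetry; apply/negP => /orP[] /xx.
- by rewrite hx // (path_edge_head xp vy).1.
- by rewrite e_sym hx // (path_edge_head xp uy).2.
by rewrite (path_edge_cons xp) //; apply: IH.
Qed.

Lemma index_split s v t : uniq (s ++ v :: t) -> index v (s ++ v :: t) = size s.
Proof.
rewrite cat_uniq => /and3P[_ nh _]; rewrite index_cat /= eqxx addn0.
case: ifP => // vs; case/hasP: nh; exists v => //; exact: mem_head.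
Qed.

Lemma index_before s v t w : uniq (s ++ v :: t) -> w \in s ++ v :: t ->
  (w \in s) = (index w (s ++ v :: t) < size s).
Proof.
move=> u wi; rewrite index_cat; case: ifP => ws; first by rewrite index_mem ws.
by rewrite ltnNge leq_addr.
Qed.

Lemma index_split_mem s v : v \in s ->
  exists s1 s2, s = s1 ++ v :: s2 /\ index v s = size s1.
Proof.
move=> vs; exists (take (index v s) s), (drop (index v s).+1 s).
rewrite -(drop_index vs) cat_take_drop size_take index_mem vs.
by [].
Qed.

(** * Distances *)

(** Walks suffice, since a walk can be shortened to a path. *)
Lemma dist_leP r u v :
  reflect (exists p, [/\ path e u p, last u p = v & size p <= r])
          (dist_le e r u v).
Proof.
apply: (iffP existsP) => [[n /existsP[p /andP[/andP[pp _] /eqP lp]]]|[p [pp lp sp]]].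
  by exists p; rewrite size_tuple -ltnS.
case/shortenP: pp lp => p' pp' up' sub lp.
have sp' : size p' < r.+1.
  rewrite ltnS; apply: leq_trans sp; apply: uniq_leq_size sub.
  by case/andP: up'.
exists (Ordinal sp'); apply/existsP; exists (in_tuple p').
by rewrite /is_path pp' up' /= lp.
Qed.

Lemma dist_le_sym r u v : dist_le e r u v -> dist_le e r v u.
Proof.
move=> /dist_leP[p [pp <- sp]]; apply/dist_leP; exists (rev (belast u p)).
rewrite rev_path size_rev size_belast (eq_path (e' := e)) => [|x y]; last exact: e_sym.
by split=> //; case: p {pp sp} => //= a p; rewrite rev_cons last_rcons.
Qed.

Lemma dist_le_trans r1 r2 u v w :
  dist_le e r1 u v -> dist_le e r2 v w -> dist_le e (r1 + r2) u w.
Proof.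
move=> /dist_leP[p [pp <- sp]] /dist_leP[p' [pp' <- sp']]; apply/dist_leP.
exists (p ++ p'); rewrite cat_path pp pp' last_cat size_cat; split=> //.
exact: leq_add.
Qed.

Lemma dist_le_edge u v : e u v -> dist_le e 1 u v.
Proof. by move=> uv; apply/dist_leP; exists [:: v]; rewrite /= uv. Qed.

Lemma path_dist_le s v w r : chordless s -> v \in s -> w \in s ->
  index v s <= index w s <= index v s + r -> dist_le e r v w.
Proof.
move=> cs /index_split_mem[s1 [s2 [Es iv]]]; rewrite {}iv; subst s.
have us := chordless_uniq cs => ws /andP[lo hi].
have H : w \in v :: s2.
  have:= ws; rewrite {1}mem_cat => /orP[w1|//].
  by move: w1; rewrite (index_before us ws) ltnNge lo.
apply/dist_leP; move: H; rewrite inE => /predU1P[->|/splitPr Es2].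
  by exists [::].
case: Es2 us cs hi {ws lo} => t1 t2 us cs hi; exists (rcons t1 w).
have E : s1 ++ v :: t1 ++ w :: t2 = (s1 ++ v :: t1) ++ w :: t2 by rewrite -catA.
move: hi; rewrite E index_split -?E // size_cat /= last_rcons size_rcons => hi.
split=> //; last by lia.
move: cs => /chordless_catr /chordless_path.
by rewrite -cat_rcons cat_path => /andP[].
Qed.

(** * Forests of legs *)

Section Forest.

Variables (A : {set T}) (l L : nat).
Hypotheses (lL : l <= L) (L3 : 2 < L).

(** A leg is stored as its first vertex, the only one that may be adjacent to
older legs, and the sequence of its other vertices. *)
Definition leg : Type := (T * seq T)%type.
Implicit Types (K C D : seq leg) (a b d Q : leg).

Definition verts b : seq T := b.1 :: b.2.

Definition touches q Q := has (e q) (verts Q).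

(** A vertex [q] whose neighbours on [Q] are as at a junction: far from both
ends of [Q], and within a window of three consecutive vertices. *)
Definition fits_on Q q :=
  {in verts Q, forall v, e q v ->
     L <= index v (verts Q) /\ index v (verts Q) + L < size (verts Q)} /\
  {in verts Q &, forall v w, e q v -> e q w ->
     index w (verts Q) <= index v (verts Q) + 2}.

Definition remote_on Q q q' :=
  {in verts Q &, forall v w, e q v -> e q' w ->
     index v (verts Q) + L <= index w (verts Q) \/
     index w (verts Q) + L <= index v (verts Q)}.

(** The conditions on a new leg that concern its first vertex only.  Keeping
them apart lets a leg be replaced by another one with the same start. *)
Definition fits K q :=
  [/\ {in K, forall Q, touches q Q -> fits_on Q q},
      {in K &, forall Q Q', touches q Q -> touches q Q' -> Q = Q'}
    & {in K &, forall Q b, b != Q -> touches q Q -> touches b.1 Q ->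
         remote_on Q q b.1}].

Definition is_leg b := chordless (verts b) && (last b.1 b.2 \in A).

Definition stem_only K b :=
  {in K, forall Q, separated b.2 (verts Q) && (b.1 \notin verts Q)}.

(** A leg that hangs from nothing must be a long [A]-path by itself; a leg that
hangs from another may be short, even a single vertex. *)
Definition rooted K b := (b.1 \in A) && (l <= size b.2) || has (touches b.1) K.

Definition attachable K b :=
  [/\ is_leg b, stem_only K b, rooted K b & fits K b.1].

(** The newest leg comes first. *)
Fixpoint forest K : Prop :=
  if K is b :: K' then forest K' /\ attachable K' b else True.

Lemma touchesP q Q : reflect (exists2 v, v \in verts Q & e q v) (touches q Q).
Proof. exact: hasP. Qed.

Lemma forest_catr K K' : forest (K ++ K') -> forest K'.
Proof. by elim: K => // a K IH [/IH]. Qed.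

Lemma forest_attachable K b K' : forest (K ++ b :: K') -> attachable K' b.
Proof. by move/forest_catr => []. Qed.

Lemma forest_notin b K : forest (b :: K) -> b \notin K.
Proof.
by move=> [_ [_ cl _ _]]; apply/negP => /cl /andP[_]; rewrite mem_head.
Qed.

Lemma forest_uniq K : forest K -> uniq K.
Proof.
by elim: K => // b K IH fb; rewrite cons_uniq forest_notin // IH //; case: fb.
Qed.

Lemma forest_leg K b : forest K -> b \in K -> is_leg b.
Proof. by move=> fK /splitPr bK; case: bK fK => K1 K2 /forest_attachable []. Qed.

(** An older leg [b] cannot hang from [Q]: an edge between its start and [Q]
would have to leave [Q] at the start of [Q] and hit [b] at an end, where
nothing may hang. *)
Lemma older_untouched Q C b : forest (Q :: C) -> b \in C -> ~~ touches b.1 Q.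
Proof.
move=> [_ [_ cl _ [fi _ _]]] bC; apply/negP => /touchesP[v].
have bb : b.1 \in verts b by exact: mem_head.
rewrite inE => /predU1P[->|vQ] ev.
  have tb : touches Q.1 b by apply/touchesP; exists b.1; rewrite // e_sym.
  have [far _] := fi b bC tb.
  have := far _ bb; rewrite e_sym => /(_ ev); rewrite /verts /= eqxx; lia.
have /andP[/separatedP sep _] := cl b bC.
by have := sep _ _ vQ bb; rewrite /apart /= e_sym ev andbF.
Qed.

Lemma forest_filter (f : pred leg) K : forest K ->
  {in K &, forall b Q, f b -> touches b.1 Q -> f Q} -> forest (filter f K).
Proof.
elim: K => // b K IH [fK [lb cl ro [fi un re]]] par.
have sub : {subset filter f K <= K} by exact: mem_subseq (filter_subseq _ _).
have fK' : forest (filter f K).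
  by apply: IH => // x y xK yK; apply: par; rewrite inE ?xK ?yK orbT.
rewrite /=; case: ifP => fb //=; split=> //; split=> //.
- by move=> Q /sub; apply: cl.
- move: ro; rewrite /rooted; case: (_ && _) => //= /hasP[Q QK tQ].
  apply/hasP; exists Q => //; rewrite mem_filter QK andbT.
  by apply: par tQ => //; rewrite inE ?eqxx ?QK ?orbT.
- split=> [Q /sub|Q Q' /sub QK /sub|Q Q' /sub QK /sub]; first exact: fi.
    exact: un.
  exact: re.
Qed.

(** Exchanging [Q] for a leg with the same start does not affect how it hangs
from older legs; the newer legs must see the same junctions on it. *)
Lemma forest_replace D Q Q' C : forest (D ++ Q :: C) -> attachable C Q' ->
    Q'.1 = Q.1 ->
    {in D, forall b, [/\ separated b.2 (verts Q'), b.1 \notin verts Q',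
       touches b.1 Q' = touches b.1 Q & touches b.1 Q' -> fits_on Q' b.1]} ->
    {in D &, forall b d, b != d -> touches b.1 Q' -> touches d.1 Q' ->
       remote_on Q' b.1 d.1} ->
  forest (D ++ Q' :: C).
Proof.
move=> + aQ' Q1; elim: D => [[fC _] _ _ //|b D IH fb hD rD].
have fQC : forest (Q :: C) by move: fb; rewrite cat_cons -cat1s catA; exact: forest_catr.
have fQC' : forest (Q' :: C) by split=> //; case: fQC.
have unt c : c \in C -> ~~ touches c.1 Q' by exact: older_untouched.
have bnot : b \notin D ++ Q :: C by exact: forest_notin fb.
have ub : uniq (D ++ Q :: C) by case: fb => /forest_uniq.
have QnD (x : leg) : x \in D ++ C -> x \in D ++ Q :: C /\ x != Q.
  move: ub; rewrite cat_uniq mem_cat => /and3P[_ /hasPn nD /andP[QC _]].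
  rewrite mem_cat inE => /orP[xD|xC]; rewrite ?xD ?xC ?orbT; split=> //.
    by apply: contraTneq xD => ->; apply: nD; exact: mem_head.
  by apply: contraTneq xC => ->.
have mem (x : leg) : x \in D ++ Q' :: C -> x = Q' \/ x \in D ++ C.
  by rewrite !mem_cat inE orbCA => /predU1P[]; [left|right].
have QK : Q \in D ++ Q :: C by rewrite mem_cat mem_head orbT.
have bD : b \in b :: D by exact: mem_head.
have [sepb nb tb fb'] := hD b bD.
case: fb => fD [lb cl ro [fi un re]]; split.
  apply: IH => // [x xD|x y xD yD]; first by apply: hD; rewrite inE xD orbT.
  by apply: rD; rewrite inE ?xD ?yD orbT.
split=> //.
- by move=> x /mem[->|/QnD[xK _]]; [rewrite sepb nb | apply: cl].
- move: ro; rewrite /rooted; case: (_ && _) => //=.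
  by rewrite !has_cat /= tb.
split.
- by move=> x /mem[->|/QnD[xK _]]; [apply: fb' | apply: fi].
- move=> x y /mem[->|/QnD[xK xQ]] /mem[->|/QnD[yK yQ]] //.
  + by rewrite tb => tQ ty; rewrite (un Q y) // eqxx in yQ.
  + by rewrite tb => tx tQ; rewrite (un Q x) // eqxx in xQ.
  by apply: un.
move=> x y /mem[->|/QnD[xK xQ]] /mem[->|yDC]; rewrite ?eqxx //.
- move=> yQ' tbQ; move: (yDC); rewrite mem_cat => /orP[yD|/unt/negbTE->] //.
  apply: rD; rewrite ?inE ?eqxx ?yD ?orbT //.
  by apply: contraNneq bnot => ->; rewrite mem_cat yD.
- by rewrite Q1 => _; apply: re; rewrite // eq_sym.
have [yK _] := QnD _ yDC; exact: re.
Qed.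

(** Either nothing hangs from anything, or there is a leg [Q] from which other
legs hang while nothing hangs from these: the newest [Q] with a leg on it. *)
Lemma newest_parent K : forest K ->
  {in K &, forall b d, b != d -> ~~ touches b.1 d} \/
  exists D Q C, [/\ K = D ++ Q :: C,
    {in D &, forall b d, b != d -> ~~ touches b.1 d} &
    has (fun b => touches b.1 Q) D].
Proof.
elim: K => [|b K IH] fb; first by left.
have old := older_untouched fb; have nb := forest_notin fb.
have [fK [_ _ _ [_ un _]]] := fb.
have ext D : {subset D <= K} -> {in D &, forall b d, b != d -> ~~ touches b.1 d} ->
    ~~ has (touches b.1) D ->
    {in b :: D &, forall b d, b != d -> ~~ touches b.1 d}.
  move=> DK hD /hasPn nt x y; rewrite !inE => /predU1P[->|xD] /predU1P[->|yD].
  - by rewrite eqxx.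
  - by move=> _; apply: nt.
  - by move=> _; apply: old; apply: DK.
  exact: hD.
have first_parent D : {subset D <= K} ->
    {in D &, forall b d, b != d -> ~~ touches b.1 d} ->
    has (touches b.1) D -> exists D1 Q D2, [/\ D = D1 ++ Q :: D2,
    {in b :: D1 &, forall b d, b != d -> ~~ touches b.1 d} & touches b.1 Q].
  move=> DK hD hh; move: DK hD; case: (split_find hh) => x s1 s2 tx nt DK hD.
  exists s1, x, s2; rewrite cat_rcons; split=> //.
  have s1D : {subset s1 <= rcons s1 x ++ s2}.
    by move=> y ys; rewrite mem_cat mem_rcons inE ys orbT.
  by apply: ext => // [y /s1D/DK|y z /s1D yD /s1D] //; apply: hD.
case: (IH fK) => [nK|[D [Q [C [EK hD pQ]]]]].
  case: (boolP (has (touches b.1) K)) => [|nt]; last by left; apply: ext.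
  case/first_parent => // D1 [Q [D2 [EK h1 tQ]]]; right.
  by exists (b :: D1), Q, D2; rewrite EK /= tQ.
have DK : {subset D <= K} by rewrite EK => x xD; rewrite mem_cat xD.
right; case: (boolP (has (touches b.1) D)) => [|nt].
  case/first_parent => // D1 [R [D2 [ED h1 tR]]].
  by exists (b :: D1), R, (D2 ++ Q :: C); rewrite EK ED -catA /= tR.
by exists (b :: D), Q, C; rewrite EK /= pQ orbT; split=> //; apply: ext.
Qed.

(** * Packing *)

Lemma forest_stem D K b : forest (D ++ K) -> b \in D ->
  stem_only K b /\ fits K b.1.
Proof.
move=> + /splitPr bD; case: bD => D1 D2.
rewrite -catA cat_cons => /forest_attachable[_ cl _ [fi un re]].
have sub : {subset K <= D2 ++ K} by move=> Q QK; rewrite mem_cat QK orbT.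
split=> [Q /sub|]; first exact: cl.
split=> [Q /sub|Q Q' /sub QK /sub|Q c /sub QK /sub]; first exact: fi.
  exact: un.
exact: re.
Qed.

Lemma untouched_separated b Q :
  separated b.2 (verts Q) && (b.1 \notin verts Q) -> ~~ touches b.1 Q ->
  separated (verts b) (verts Q).
Proof.
move=> /andP[sep nb] /hasPn nt; rewrite /separated allrel_consl; apply/andP; split=> //.
apply/allP => x xQ; rewrite /apart /= nt // andbT.
by apply: contraNneq nb => ->.
Qed.

Lemma forest_separated K b d : forest K -> b \in K -> d \in K -> b != d ->
  ~~ touches b.1 d -> ~~ touches d.1 b -> separated (verts b) (verts d).
Proof.
move=> fK bK dK nbd tb td; case/splitPr: bK fK dK => K1 K2.
rewrite mem_cat inE eq_sym (negbTE nbd) /= => fK /orP[d1|d2].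
  have [cl _] := forest_stem fK d1; rewrite separatedC.
  by apply: untouched_separated td; apply: cl; exact: mem_head.
have [_ cl _ _] := forest_attachable fK.
by apply: untouched_separated tb; apply: cl.
Qed.

Lemma remote_onC Q q q' : remote_on Q q q' -> remote_on Q q' q.
Proof. by move=> re v w vQ wQ ev ew; case: (re w v wQ vQ ew ev); [right|left]. Qed.

Lemma forest_remote D Q C : forest (D ++ Q :: C) ->
  {in D &, forall b d, b != d -> touches b.1 Q -> touches d.1 Q ->
     remote_on Q b.1 d.1}.
Proof.
elim: D => // c D IH fD.
have := forest_uniq fD; rewrite cat_cons cons_uniq => /andP[_ uD].
have [fD' [_ _ _ [_ _ re]]] := fD.
have QD : Q \in D ++ Q :: C by rewrite mem_cat mem_head orbT.
have Dsub (b : leg) : b \in D -> b \in D ++ Q :: C /\ b != Q.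
  move=> bD; rewrite mem_cat bD; split=> //; apply: contraTneq bD => ->.
  by move: uD; rewrite cat_uniq => /and3P[_ /hasPn nD _]; apply: nD; exact: mem_head.
move=> b d; rewrite !inE => /predU1P[->|bD] /predU1P[->|dD].
- by rewrite eqxx.
- by move=> _ tb td; have [dK dQ] := Dsub d dD; apply: re.
- by move=> _ tb td; apply: remote_onC; have [bK bQ] := Dsub b bD; apply: re.
exact: IH.
Qed.

Lemma addL_gt i : (i + L <= i) = false.
Proof. by rewrite -{2}[i]addn0 leq_add2l leqn0 -(subnKC L3). Qed.

Definition good P := [/\ chordless P, ends_in A P & l < size P].

(** The path [E] of the packing argument.  Nothing hangs from [Q] below [v], so
the rest of the forest meets [E] only above: other junctions on [Q] are at
distance at least [L] from [v], and the neighbours of [d] on [Q] all lie within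
distance 2 of [v].  The last claim is what separates [E] from the part of [Q]
that is kept. *)
Lemma lowest_junction D Q C d s1 v s2 : forest (D ++ Q :: C) ->
    {in D &, forall b c, b != c -> ~~ touches b.1 c} ->
    d \in D -> verts Q = s1 ++ v :: s2 -> e d.1 v ->
    {in D, forall b, {in s2, forall x, ~~ e b.1 x}} ->
    let E := rev (verts d) ++ v :: s2 in
  [/\ good E,
      {in D ++ C, forall b, b != d -> separated E (verts b)} &
      {in verts Q, forall x, index x (verts Q) + L <= index v (verts Q) ->
         all (apart x) E}].
Proof.
move=> fD nt dD EQ edv low E.
have fQ : forest (Q :: C) by exact: forest_catr fD.
have [_ [/andP[cQ lQ] clQ _ _]] := fQ.
have vQ : v \in verts Q by rewrite EQ mem_cat mem_head orbT.
have s2Q : {subset v :: s2 <= verts Q} by move=> x xs; rewrite EQ mem_cat xs orbT.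
have tQ : touches d.1 Q by apply/touchesP; exists v.
have [cld [fid und _]] := forest_stem fD dD.
have [far short] := fid Q (mem_head _ _) tQ.
have [sepd nd] := andP (cld Q (mem_head _ _)).
have iv : index v (verts Q) = size s1.
  by rewrite EQ index_split // -EQ chordless_uniq.
have [] := far v vQ edv; rewrite iv => farl farr.
have dK : d \in D ++ Q :: C by rewrite mem_cat dD.
have /andP[cd ld] := forest_leg fD dK.
have s2Q2 : {subset v :: s2 <= Q.2}.
  case: s1 EQ farl {farr iv} => [|a s1] EQ; first by rewrite /= leqn0 -(subnKC L3).
  by case: EQ => _ -> _ x xs; rewrite mem_cat xs orbT.
have nQC : Q \notin C by exact: forest_notin fQ.
split.
- split.
  + rewrite /E rev_cons chordless_cat -rev_cons chordless_rev cd edv /=.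
    apply/and3P; split.
    * by move: cQ; rewrite EQ => /chordless_catr.
    * by apply: separatedS sepd => // x; rewrite mem_rev.
    apply/allP => x xs; rewrite /apart /= low // andbT.
    by apply: contraNneq nd => ->; apply: s2Q; rewrite inE xs orbT.
  + rewrite /E /verts lastI rev_rcons /= ld last_cat /=.
    suff -> : last v s2 = last Q.1 Q.2 by [].
    by rewrite -[RHS]/(last Q.1 (verts Q)) EQ last_cat.
  rewrite /E size_cat size_rev /=.
  by move: farr; rewrite EQ size_cat /= => farr; clear -farr lL; lia.
- move=> b; rewrite mem_cat => bDC nbd.
  rewrite /separated allrel_catl; apply/andP; split.
    rewrite -/(separated _ _); apply: (@separatedS _ (verts d) _ (verts b)) => //.
      by move=> x; rewrite mem_rev.
    case/orP: bDC => [bD|bC].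
      apply: forest_separated fD dK _ _ _ _; rewrite ?mem_cat ?bD //.
      - by rewrite eq_sym.
      - by apply: nt; rewrite // eq_sym.
      by apply: nt.
    apply: untouched_separated; first by apply: cld; rewrite inE bC orbT.
    apply/negP => tb; have Qb : Q = b by apply: und; rewrite ?inE ?eqxx ?bC ?orbT.
    by rewrite Qb bC in nQC.
  rewrite -/(separated _ _); case/orP: bDC => [bD|bC]; last first.
    have /andP[sQ _] := clQ b bC; exact: separatedS sQ.
  have [clb _] := forest_stem fD bD.
  have [sepb nb] := andP (clb Q (mem_head _ _)).
  rewrite separatedC /separated allrel_consl -/(separated _ _).
  apply/andP; split; last exact: separatedS sepb.
  apply/allP => x xs; rewrite /apart /=; apply/andP; split.
    by apply: contraNneq nb => ->; apply: s2Q.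
  move: xs; rewrite inE => /predU1P[->|]; last exact: low.
  apply/negP => ebv.
  have tb : touches b.1 Q by apply/touchesP; exists v.
  have re : remote_on Q b.1 d.1 by exact: forest_remote fD _ _ bD dD nbd tb tQ.
  by case: (re v v vQ vQ ebv edv); rewrite addL_gt.
move=> x xQ ixv; rewrite /E all_cat all_rev.
have nex : ~~ e d.1 x.
  by apply/negP => edx; have h := short x v xQ vQ edx edv; clear -h ixv iv L3; lia.
apply/andP; split.
  rewrite [all _ _]/=; apply/andP; split.
    rewrite apartC /apart /= nex andbT.
    by apply: contraNneq nd => ->.
  apply/allP => y yd; rewrite apartC.
  exact: (separatedP _ _ sepd).
have x1 : x \in s1.
  have := xQ; rewrite EQ => xQ'; rewrite (@index_before s1 v s2) //.
    by rewrite -EQ; clear -ixv iv L3; lia.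
  by rewrite -EQ chordless_uniq.
have [t1 [t2 [E1 i1]]] := index_split_mem x1.
have i1' : index x (verts Q) = size t1 by rewrite EQ index_cat x1.
case: t2 E1 => [|y [|z t2]] E1;
  try by (move: ixv; rewrite i1' E1 size_cat /= => ixv; clear -ixv L3; lia).
have sep : separated (rcons t1 x) (z :: t2 ++ v :: s2).
  apply: (@chordless_separated _ y); move: cQ; rewrite EQ E1.
  by rewrite -cats1 -!catA.
apply/allP => w ws; apply: (separatedP _ _ sep); first by rewrite mem_rcons mem_head.
by rewrite inE mem_cat ws !orbT.
Qed.

Definition cover K := flatten (map verts K).

Lemma coverP K x : reflect (exists2 b, b \in K & x \in verts b) (x \in cover K).
Proof. exact: flatten_mapP. Qed.

Lemma forest_rem K d : forest K -> {in K, forall b, b != d -> ~~ touches b.1 d} ->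
  forest (rem d K).
Proof.
move=> fK nt; rewrite rem_filter ?forest_uniq //; apply: forest_filter => // b Q bK _ bd.
by apply: contraTneq => ->; apply: nt.
Qed.

Lemma last_split (f : pred T) s : has f s ->
  exists s1 v s2, [/\ s = s1 ++ v :: s2, f v & {in s2, forall x, ~~ f x}].
Proof.
elim: s => // x s IH; case: (boolP (has f s)) => [/IH [s1 [v [s2 [-> fv ns]]]] _|ns].
  by exists (x :: s1), v, s2.
by rewrite /= (negbTE ns) orbF => fx; exists [::], x, s; split=> //; apply/hasPn.
Qed.

Lemma first_split (f : pred T) s : has f s ->
  exists s1 v s2, [/\ s = s1 ++ v :: s2, f v & {in s1, forall x, ~~ f x}].
Proof.
case/split_find => x s1 s2 fx /hasPn ns; exists s1, x, s2; rewrite cat_rcons.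
by split.
Qed.

(** The paths must stay inside the forest, for in the induction this is what
separates them from the path output before. *)
Definition packing K := exists Ps,
  [/\ uphalf (size K) <= size Ps, pairwise separated Ps,
      {in Ps, forall P, good P} & {in Ps, forall P, {subset P <= cover K}}].

Lemma packing_cons E K K' : size K = (size K').+2 -> good E ->
    {subset E <= cover K} -> {subset cover K' <= cover K} ->
    {in K', forall b, separated E (verts b)} ->
  packing K' -> packing K.
Proof.
move=> sK gE EK KK sep [Ps [sPs pw gPs cPs]]; exists (E :: Ps); split.
- by rewrite sK /= ltnS.
- rewrite pairwise_cons pw andbT; apply/allP => P PPs.
  apply/separatedP => x y xE /(cPs _ PPs)/coverP[b bK' yb].
  by apply: (separatedP _ _ (sep b bK')).
- by move=> P; rewrite inE => /predU1P[->|/gPs].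
move=> P; rewrite inE => /predU1P[->|/cPs cP] // x /cP; exact: KK.
Qed.

Lemma rootless_packing K : forest K ->
  {in K &, forall b d, b != d -> ~~ touches b.1 d} -> packing K.
Proof.
move=> fK nt; exists (map verts K); rewrite size_map; split.
- by rewrite leq_uphalf_double -addnn leq_addr.
- elim: K fK nt => // b K IH fb nt; rewrite map_cons pairwise_cons.
  have nb := forest_notin fb; have [fK _] := fb.
  rewrite IH //; last by move=> x y xK yK; apply: nt; rewrite inE ?xK ?yK orbT.
  rewrite andbT; apply/allP => _ /mapP[d dK ->].
  have nbd : b != d by apply: contraNneq nb => ->.
  apply: (forest_separated fb _ _ nbd); rewrite ?inE ?eqxx ?dK ?orbT //.
    by apply: nt; rewrite ?inE ?eqxx ?dK ?orbT.
  by apply: nt; rewrite ?inE ?eqxx ?dK ?orbT // eq_sym.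
- move=> _ /mapP[b bK ->]; have := forest_leg fK bK => /andP[cb lb].
  have : (b.1 \in A) && (l <= size b.2).
    move: nt (forest_uniq fK); case/splitPr: bK fK => K1 K2 /forest_attachable[_ _ + _] nt.
    rewrite /rooted; case: (_ && _) => //= /hasP[Q Q2 tQ].
    rewrite cat_uniq /= => /and3P[_ _ /andP[b2 _]].
    suff: ~~ touches b.1 Q by rewrite tQ.
    by apply: nt; rewrite ?mem_cat ?inE ?eqxx ?Q2 ?orbT //; apply: contraNneq b2 => ->.
  by move=> /andP[b1 sb]; split; rewrite //= ?b1.
by move=> _ /mapP[b bK ->] x xb; apply/coverP; exists b.
Qed.

(** By induction on the number of legs: two legs are traded for one path.  It
is essential that the kept part of [Q] ends at the first neighbour [w2] of
[d2], and the output path starts at the last neighbour [v] of [d]. *)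
Lemma forest_packing K : forest K -> packing K.
Proof.
have [n] := ubnP (size K); elim: n K => // n IH K; rewrite ltnS => sKn fK.
case: (newest_parent fK) => [|[D [Q [C [EK nt pQ]]]]]; first exact: rootless_packing.
subst K; have uK := forest_uniq fK; set V := verts Q.
have fQ : forest (Q :: C) by exact: forest_catr fK.
have [_ [/andP[cV lQ] clQ roQ fitsQ]] := fQ.
have uV : uniq V by exact: chordless_uniq.
have QK : Q \in D ++ Q :: C by rewrite mem_cat mem_head orbT.
have nQD : Q \notin D.
  by move: uK; rewrite cat_uniq => /and3P[_ /hasPn/(_ Q (mem_head _ _))].
have uD : uniq D by move: uK; rewrite cat_uniq => /and3P[].
have DK b : b \in D -> b \in D ++ Q :: C by move=> bD; rewrite mem_cat bD.
(* [v] is the lowest vertex of [Q] adjacent to a leg hanging from it. *)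
have [|s1 [v [s2 [EV /hasP[d dD edv] low]]]] :=
  @last_split (fun v => has (fun b => e b.1 v) D) V.
  case/hasP: pQ => b bD /touchesP[v vV ev].
  by apply/hasP; exists v => //; apply/hasP; exists b.
have [] := lowest_junction fK nt dD EV edv.
  by move=> b bD x /low /hasPn; apply.
set E := rev _ ++ _ => gE sepE highE.
have vV : v \in V by rewrite EV mem_cat mem_head orbT.
have iv : index v V = size s1 by rewrite EV index_split // -EV.
have EK : {subset E <= cover (D ++ Q :: C)}.
  move=> x; rewrite /E mem_cat mem_rev => /orP[xd|xs]; apply/coverP.
    by exists d; rewrite ?DK.
  by exists Q; rewrite // -/V EV mem_cat xs orbT.
have Cold b c : b \in C -> c \in D ++ [:: Q] -> ~~ touches b.1 c.
  move=> bC cD; move: fK; rewrite -cat1s catA.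
  case/splitPr: cD => D1 D2; rewrite -catA cat_cons => /forest_catr fc.
  by apply: older_untouched fc _; rewrite mem_cat bC orbT.
have Qold c : c \in D -> ~~ touches Q.1 c.
  move=> cD; case/splitPr: cD fK => D1 D2; rewrite -catA cat_cons => /forest_catr fc.
  by apply: older_untouched fc _; rewrite mem_cat mem_head orbT.
have nDC b : b \in C -> b \notin D.
  move=> bC; move: uK; rewrite cat_uniq => /and3P[_ /hasPn nD _].
  by apply: nD; rewrite inE bC orbT.
have remD b D' : {subset D' <= D} -> uniq D' -> forest (D' ++ Q :: C) -> b \in D' ->
    forest (rem b D' ++ Q :: C) /\ size D' = (size (rem b D')).+1.
  move=> D'D uD' fD' bD'; split; last first.
    by rewrite size_rem // prednK // -has_predT; apply/hasP; exists b.
  have -> : rem b D' ++ Q :: C = rem b (D' ++ Q :: C).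
    rewrite !rem_filter ?(forest_uniq fD') // filter_cat; congr (_ ++ _).
    apply/esym/all_filterP/allP => x; rewrite inE => /predU1P[->|xC] /=.
      by apply: contraNneq nQD => ->; apply: D'D.
    by apply: contraTneq (nDC _ xC) => ->; rewrite D'D.
  apply: forest_rem => // x; rewrite mem_cat inE => /or3P[xD|/eqP->|xC] xb.
  - by apply: nt => //; apply: D'D.
  - by apply: Qold; apply: D'D.
  by apply: Cold; rewrite // mem_cat D'D.
have [fD1 sD1] := remD d D (fun=> id) uD fK dD.
set D1 := rem d D in fD1 sD1.
have mD1 b : b \in D1 = (b != d) && (b \in D) by exact: mem_rem_uniq.
have D1D : {subset D1 <= D} by move=> b; rewrite mD1 => /andP[].
have uD1 : uniq D1 by exact: rem_uniq.
case: (boolP (has (fun v => has (fun b => e b.1 v) D1) V)) => [hit|/hasPn ntQ]; last first.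
  have fD1C : forest (D1 ++ C).
    have -> : D1 ++ C = rem Q (D1 ++ Q :: C).
      rewrite rem_filter ?forest_uniq // filter_cat /= eqxx.
      congr (_ ++ _); apply/esym/all_filterP/allP => x /=.
        by move=> /D1D; apply: contraTneq => ->.
      by apply: contraTneq => ->; exact: forest_notin fQ.
    apply: forest_rem => // b; rewrite mem_cat inE => /or3P[bD|->//|bC] bQ.
      apply/negP => /touchesP[x xV ex]; have /hasPn/(_ b bD) := ntQ x xV.
      by rewrite ex.
    by apply: Cold; rewrite // mem_cat inE eqxx orbT.
  apply: (@packing_cons E _ (D1 ++ C)) => //.
  - by rewrite !size_cat /= sD1 addnS.
  - move=> x /coverP[b bK xb]; apply/coverP; exists b => //.
    move: bK; rewrite !mem_cat inE => /orP[/D1D ->|->] //.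
    by rewrite !orbT.
  - move=> b; rewrite mem_cat => /orP[bD|bC].
      by apply: sepE; move: bD; rewrite mD1 ?mem_cat => /andP[] // _ ->.
    apply: sepE; first by rewrite mem_cat bC orbT.
    by apply: contraTneq (nDC b bC) => ->; rewrite dD.
  apply: IH => //.
  by move: sKn; rewrite !size_cat sD1 /= addSn addnS => /ltnW.
(* [d2] is the lowest leg on [Q] once [d] is gone, with last neighbour [v2] and
   first neighbour [w2]. *)
have [t1 [v2 [t2 [EV2 /hasP[d2 d2D1 e2] low2]]]] := last_split hit.
have v2V : v2 \in V by rewrite EV2 mem_cat mem_head orbT.
have [|r1 [w2 [r2 [EVr ew2 high2]]]] := @first_split (e d2.1) V.
  by apply/hasP; exists v2.
have w2V : w2 \in V by rewrite EVr mem_cat mem_head orbT.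
have iv2 : index v2 V = size t1 by rewrite EV2 index_split // -EV2.
have iw2 : index w2 V = size r1 by rewrite EVr index_split // -EVr.
have [fD2 sD2] := remD d2 D1 D1D uD1 fD1 d2D1.
set D2 := rem d2 D1 in fD2 sD2.
have mD2 b : b \in D2 = (b != d2) && (b \in D1) by exact: mem_rem_uniq.
have D2D1 : {subset D2 <= D1} by move=> b; rewrite mD2 => /andP[].
have d2D : d2 \in D by exact: D1D.
have touchV b x : x \in V -> e b.1 x -> touches b.1 Q.
  by move=> xV ex; apply/touchesP; exists x.
have tQ2 := touchV d2 w2 w2V ew2.
have tQd := touchV d v vV edv.
have rem2 b c : b \in D -> c \in D -> b != c -> touches b.1 Q -> touches c.1 Q ->
  remote_on Q b.1 c.1 by move=> bD cD; exact: forest_remote fK _ _ bD cD.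
have [cl2 [fi2 un2 _]] := forest_stem fK d2D.
have [far2 short2] := fi2 Q (mem_head _ _) tQ2.
have [farw _] := far2 w2 w2V ew2.
(* The remaining legs hang from [Q] well above [w2]: their neighbours are not
   below [v2], and keep distance [L] from both [v2] and [w2], which are at most
   2 apart. *)
have above b x : b \in D2 -> x \in V -> e b.1 x -> index x V + L <= size r1.
  move=> bD2 xV ex; have tb := touchV b x xV ex.
  have bD1 := D2D1 b bD2; have bD := D1D b bD1.
  have nb2 : b != d2 by move: bD2; rewrite mD2 => /andP[].
  have h1 := rem2 b d2 bD d2D nb2 tb tQ2 x v2 xV v2V ex e2.
  have h2 := rem2 b d2 bD d2D nb2 tb tQ2 x w2 xV w2V ex ew2.
  have h3 := short2 w2 v2 w2V v2V ew2 e2.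
  have h4 : index x V <= index v2 V.
    rewrite iv2 leqNgt; apply/negP => lt.
    have : x \in t2.
      move: xV; rewrite EV2 mem_cat inE => /or3P[x1|/eqP xv|//].
        by move: lt; rewrite EV2 index_cat x1 ltnNge index_size.
      by move: lt; rewrite xv iv2 ltnn.
    by move/low2/hasPn/(_ b bD1); rewrite ex.
  by rewrite -iw2; move: h1 h2 h3 h4; rewrite -/V; clear -L3; lia.
have w2v : index w2 V + L <= index v V.
  have nd2 : d2 != d by move: d2D1; rewrite mD1 => /andP[].
  case: (rem2 d2 d d2D dD nd2 tQ2 tQd w2 v w2V vV ew2 edv) => // h.
  have lt : size s1 < index w2 V by rewrite -iv; move: h; rewrite -/V; clear -L3; lia.
  have : w2 \in s2.
    move: w2V; rewrite {1}EV mem_cat inE => /or3P[x1|/eqP xv|//].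
      by move: lt; rewrite EV index_cat x1 ltnNge index_size.
    by move: lt; rewrite xv iv ltnn.
  by move/low/hasPn/(_ d2 d2D); rewrite ew2.
case: r1 EVr high2 iw2 above farw => [|q1 r1] EVr high2 iw2 above farw.
  by move: farw; rewrite -/V iw2 /=; clear -L3; lia.
move: (EVr) => [q1E QE]; subst q1.
(* [Q] down to [w2], continued by [d2], which restores an end in [A]. *)
pose Q' : leg := (Q.1, r1 ++ w2 :: verts d2).
have EV' : verts Q' = rcons (Q.1 :: r1) w2 ++ verts d2 by rewrite cat_rcons.
have upV : {subset rcons (Q.1 :: r1) w2 <= V}.
  by move=> x xr; rewrite EVr -cat_rcons mem_cat xr.
have /andP[sep2 n2] := cl2 Q (mem_head _ _).
have /andP[c2 l2] := forest_leg fK (DK _ d2D).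
have d2C b : b \in C -> separated (verts d2) (verts b).
  move=> bC; apply: untouched_separated; first by apply: cl2; rewrite inE bC orbT.
  apply/negP => tb; have Qb : Q = b by apply: un2; rewrite ?inE ?eqxx ?bC ?orbT.
  by move: (forest_notin fQ); rewrite Qb bC.
have sepr : separated (Q.1 :: r1) (verts d2).
  apply/separatedP => x y xr; have xV : x \in V.
    by apply: upV; rewrite mem_rcons inE xr orbT.
  rewrite apartC inE => /predU1P[->|y2]; last exact: (separatedP _ _ sep2).
  by rewrite /apart /= high2 // andbT; apply: contraNneq n2 => ->.
have aQ' : attachable C Q'.
  split=> //.
  - rewrite /is_leg EV' chordless_cat c2 e_sym ew2 sepr last_cat /= l2 andbT.
    apply/andP; split.
      by move: cV; rewrite -/V EVr -cat_rcons => /chordless_catl.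
    by apply/allP => x x2; rewrite apartC; apply: (separatedP _ _ sep2).
  - move=> b bC; have /andP[sQ nQ] := clQ b bC; rewrite nQ andbT.
    rewrite /Q' /= -cat_rcons /separated allrel_catl -!/(separated _ _) d2C // andbT.
    by apply: separatedS sQ => // x xr; rewrite QE -cat_rcons mem_cat xr.
  move: roQ; rewrite /rooted /= => /orP[/andP[-> _]|->]; rewrite ?orbT //.
  rewrite size_cat /=; move: farw; rewrite -/V iw2 /=; clear -lL; lia.
have sepD2 b : b \in D2 -> separated (verts b) (verts d2).
  move=> bD2; have bD := D1D _ (D2D1 _ bD2).
  have nb2 : b != d2 by move: bD2; rewrite mD2 => /andP[].
  by apply: (forest_separated fK); rewrite ?DK //; apply: nt; rewrite // eq_sym.
have loc b x : b \in D2 -> x \in verts Q' -> e b.1 x ->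
    [/\ x \in V, index x (verts Q') = index x V & index x V + L <= size (Q.1 :: r1)].
  move=> bD2; rewrite {1}EV' mem_cat => /orP[/upV xV|x2] ex; last first.
    have := separatedP _ _ (sepD2 b bD2) _ _ (mem_head _ _) x2.
    by rewrite /apart /= ex andbF.
  have ix := above b x bD2 xV ex.
  have xr : x \in Q.1 :: r1.
    rewrite (@index_before (Q.1 :: r1) w2 r2) -?EVr //.
    by move: ix; clear -L3; lia.
  split=> //; rewrite EVr index_cat xr.
  by rewrite -[verts Q']/((Q.1 :: r1) ++ w2 :: verts d2) index_cat xr.
have fK' : forest (D2 ++ Q' :: C).
  apply: forest_replace fD2 aQ' _ _ _ => // [b bD2|b d0 bD2 dD2 nbd _ _].
    have bD := D1D _ (D2D1 _ bD2).
    have [clb [fib _ _]] := forest_stem fK bD.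
    have /andP[sepb nb] := clb Q (mem_head _ _).
    have tbQ : touches b.1 Q' = touches b.1 Q.
      apply/touchesP/touchesP => [[x xQ' ex]|[x xV ex]]; exists x => //.
        by case: (loc b x bD2 xQ' ex).
      have ix := above b x bD2 xV ex.
      rewrite EV' mem_cat mem_rcons inE (@index_before (Q.1 :: r1) w2 r2) -?EVr //.
      by apply/orP; left; apply/orP; right; move: ix; clear -L3; lia.
    split=> //.
    - rewrite EV' separatedC /separated allrel_catl -!/(separated _ _).
      apply/andP; split; rewrite separatedC; first exact: separatedS sepb.
      by apply: separatedS (sepD2 b bD2) => // x; rewrite inE => ->; rewrite orbT.
    - rewrite EV' mem_cat negb_or; apply/andP; split.
        by apply: contraNN nb => /upV.
      apply/negP => b2; have := separatedP _ _ (sepD2 b bD2) _ _ (mem_head _ _) b2.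
      by rewrite /apart /= eqxx.
    rewrite tbQ => tb; have [farb shortb] := fib Q (mem_head _ _) tb.
    split=> [x xQ' ex|x y xQ' yQ' ex ey].
      have [xV -> ix] := loc b x bD2 xQ' ex.
      have [h _] := farb x xV ex; split=> //.
      by rewrite EV' size_cat size_rcons; move: ix; clear; rewrite /verts /=; lia.
    have [xV -> _] := loc b x bD2 xQ' ex; have [yV -> _] := loc b y bD2 yQ' ey.
    exact: shortb.
  move=> x y xQ' yQ' ex ey.
  have [xV -> _] := loc b x bD2 xQ' ex; have [yV -> _] := loc d0 y dD2 yQ' ey.
  apply: (rem2 b d0) => //; rewrite ?(D1D _ (D2D1 _ _)) //.
    by apply/touchesP; exists x.
  by apply/touchesP; exists y.
apply: (@packing_cons E _ (D2 ++ Q' :: C)) => //.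
- by rewrite !size_cat /= sD1 sD2.
- move=> x /coverP[b]; rewrite mem_cat inE => /or3P[bD|/eqP->|bC] xb.
  + by apply/coverP; exists b; rewrite // DK // D1D // D2D1.
  + move: xb; rewrite EV' mem_cat => /orP[/upV xV|x2]; apply/coverP.
      by exists Q.
    by exists d2; rewrite // DK.
  by apply/coverP; exists b; rewrite // mem_cat inE bC !orbT.
- move=> b; rewrite mem_cat inE => /or3P[/D2D1|/eqP->|bC].
  + by rewrite mD1 => /andP[bd bD]; apply: sepE; rewrite // mem_cat bD.
  + rewrite EV' /separated allrel_catr; apply/andP; split; last first.
      by apply: sepE; move: d2D1; rewrite mD1 ?mem_cat => /andP[] // _ ->.
    rewrite -/(separated _ _) separatedC; apply/separatedP => x y xr.
    apply: (allP _ y); apply: highE (upV x xr) _; apply: leq_trans w2v.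
    rewrite leq_add2r iw2; move: xr; rewrite mem_rcons inE => /predU1P[->|xr].
      by rewrite -/V iw2.
    by rewrite -/V EVr index_cat xr ltnW // index_mem.
  apply: sepE; first by rewrite mem_cat bC orbT.
    by apply: contraTneq (nDC b bC) => ->; rewrite dD.
apply: IH => //.
by move: sKn; rewrite !size_cat sD1 sD2 /= !addSn => /ltnW.
Qed.

(** * The guard of a greedy forest *)

Definition end_zone b :=
  take L.+1 (verts b) ++ drop (size (verts b) - L.+1) (verts b).

Definition junction_zone Q q :=
  [seq w <- verts Q | has (fun v => [&& e q v,
     index v (verts Q) < index w (verts Q) + L &
     index w (verts Q) < index v (verts Q) + L]) (verts Q)].

(** A leg hangs from at most one older leg, so that the first one found is the
right one. *)
Definition attachment_zone K b :=
  if [seq Q <- K | touches b.1 Q] is Q :: _ then junction_zone Q b.1 else [::].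

Fixpoint guard K : seq T :=
  if K is b :: K' then end_zone b ++ attachment_zone K' b ++ guard K' else [::].

Lemma mem_guard b K v : v \in guard (b :: K) =
  [|| v \in end_zone b, v \in attachment_zone K b | v \in guard K].
Proof. by rewrite -!mem_cat. Qed.

(** Each leg was a shortest one that could be added to the older ones. *)
Fixpoint greedy K : Prop :=
  if K is b :: K' then
    [/\ greedy K', forest K &
        forall b', forest (b' :: K') -> size b.2 <= size b'.2]
  else True.

Lemma greedy_forest K : greedy K -> forest K.
Proof. by case: K => // b K []. Qed.

Lemma end_zoneP b v : v \in verts b -> v \notin end_zone b ->
  L < index v (verts b) /\ index v (verts b) + L.+1 < size (verts b).
Proof.
move=> vb; rewrite mem_cat negb_or in_take // -leqNgt => /andP[h1 h2]; split=> //.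
have : v \in take (size (verts b) - L.+1) (verts b).
  move: vb; rewrite -{1}(cat_take_drop (size (verts b) - L.+1) (verts b)).
  by rewrite mem_cat (negbTE h2) orbF.
by rewrite in_take // ltn_subRL addnC.
Qed.

Lemma attachable_restem K b b' : attachable K b -> b'.1 = b.1 -> is_leg b' ->
  {in K, forall Q, separated b'.2 (verts Q)} -> rooted K b' -> attachable K b'.
Proof.
move=> [_ cl _ fi] E lb sep ro; split=> //; last by rewrite E.
by move=> Q QK; rewrite sep // E; case/andP: (cl Q QK).
Qed.

(** Otherwise replace the part of [Q] strictly between the first and the last
neighbour of [q] by [q] itself: a strictly shorter leg with the same ends,
which was available when [Q] was chosen because [q] has no neighbour in [K]. *)
Lemma greedy_no_shortcut K Q q : greedy (Q :: K) ->
    q \notin verts Q -> {in K, forall b, separated [:: q] (verts b)} ->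
    {in verts Q, forall v, e q v -> L < index v (verts Q)} ->
  {in verts Q &, forall v w, e q v -> e q w ->
     index w (verts Q) <= index v (verts Q) + 2}.
Proof.
move=> [_ [fK aQ] minQ] nq sepq far v w vQ wQ ev ew; rewrite leqNgt; apply/negP => lt.
have [/andP[cQ lQ] clQ roQ _] := aQ; have uQ := chordless_uniq cQ.
have [|s1 [w0 [s2 [EQ ew0 n2]]]] := @last_split (e q) (verts Q).
  by apply/hasP; exists w.
have iw0 : index w0 (verts Q) = size s1 by rewrite EQ index_split // -EQ.
have lew : index w (verts Q) <= size s1.
  rewrite leqNgt; apply/negP => lt2.
  have : w \in s2; last by move/n2; rewrite ew.
  move: wQ; rewrite EQ mem_cat inE => /or3P[w1|/eqP ww|//].
    by move: lt2; rewrite EQ index_cat w1 ltnNge index_size.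
  by move: lt2; rewrite ww iw0 ltnn.
have v1 : v \in s1.
  by rewrite (@index_before s1 w0 s2) -EQ //; move: lt lew; clear; lia.
have [|r1 [v0 [m [E1 ev0 n1]]]] := @first_split (e q) s1.
  by apply/hasP; exists v.
subst s1; rewrite -catA cat_cons in EQ.
have v0Q : v0 \in verts Q by rewrite EQ mem_cat mem_head orbT.
have iv0 : index v0 (verts Q) = size r1 by rewrite EQ index_split // -EQ.
have sm : 1 < size m.
  have lev : size r1 <= index v (verts Q).
    rewrite leqNgt; apply/negP => lt2.
    by have := n1 v; rewrite (@index_before r1 v0 (m ++ w0 :: s2)) -EQ // ev => /(_ lt2).
  by move: lt lew lev; rewrite size_cat /=; clear; lia.
have := far v0 v0Q ev0; rewrite iv0.
case: r1 n1 EQ iv0 {lew v1 iw0} => // q1 r1 n1 EQ iv0 lr.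
move: (EQ) => [q1E EQ2]; subst q1.
pose Q' : leg := (Q.1, r1 ++ [:: v0, q, w0 & s2]).
have EQ' : verts Q' = rcons (Q.1 :: r1) v0 ++ [:: q, w0 & s2] by rewrite cat_rcons.
case: m sm EQ EQ2 => // m1 m sm EQ EQ2.
have sepv : separated (rcons (Q.1 :: r1) v0) (m ++ w0 :: s2).
  by apply: (@chordless_separated _ m1); rewrite cat_rcons -EQ.
have r1Q2 : {subset rcons r1 v0 <= Q.2}.
  by move=> x xr; rewrite EQ2 -cat_rcons mem_cat xr.
have s2Q2 : {subset w0 :: s2 <= Q.2}.
  by move=> x xs; rewrite EQ2 -cat_rcons !mem_cat xs !orbT.
have Q2V : {subset Q.2 <= verts Q} by move=> x xQ; rewrite inE xQ orbT.
have qV x : x \in verts Q -> ~~ e q x -> apart q x.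
  by move=> xQ nx; rewrite /apart /= nx andbT; apply: contraNneq nq => ->.
have fQ' : forest (Q' :: K).
  split=> //; apply: attachable_restem aQ _ _ _ _ => //.
  - have lQ' : last Q'.1 Q'.2 \in A.
      by move: lQ; rewrite EQ2 /Q' /= !last_cat /= last_cat.
    rewrite /is_leg EQ' lQ' andbT chordless_cat e_sym; apply/and5P; split=> //.
    + by move: cQ; rewrite EQ -cat_rcons => /chordless_catl.
    + rewrite chordless_cons2 ew0 andTb; apply/andP; split.
        by apply/allP => x xs; apply: qV (n2 x xs); apply/Q2V/s2Q2; rewrite inE xs orbT.
      by move: cQ; rewrite EQ -cat_cons catA => /chordless_catr.
    + apply/separatedP => x y xr; rewrite inE => /predU1P[->|ys].
        by rewrite apartC; apply: qV (n1 x xr); rewrite EQ mem_cat xr.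
      apply: (separatedP _ _ sepv); last by rewrite mem_cat ys orbT.
      by rewrite mem_rcons in_cons xr orbT.
    apply/allP => y ys; apply: (separatedP _ _ sepv).
      by rewrite mem_rcons mem_head.
    by rewrite mem_cat ys orbT.
  - move=> b bK; have /andP[sb _] := clQ b bK.
    rewrite /Q' /= -cat_rcons /separated allrel_catl -cat1s allrel_catl -!/(separated _ _).
    by rewrite sepq // !(separatedS _ _ sb).
  move: roQ; rewrite /rooted /= => /orP[/andP[-> _]|->]; rewrite ?orbT //.
  by rewrite size_cat /=; move: lr lL; clear; rewrite /=; lia.
have := minQ _ fQ'; rewrite leqNgt EQ2 /= !size_cat /= !size_cat /=.
by move: sm; clear; rewrite /=; lia.
Qed.

(** By induction on the forest, the newest leg [Q] coming last.  If the start of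
[s] has neighbours in the older legs, the induction hypothesis makes [s] a leg
over these; a neighbour on [Q] as well would give the shorter leg that starts
like [s] and continues along the lower part of [Q]. *)
Lemma forest_extend K (s : leg) : greedy K -> is_leg s -> stem_only K s -> rooted K s ->
    {in K, forall Q, {in verts Q, forall v, e s.1 v -> v \notin guard K}} ->
  forest (s :: K).
Proof.
elim: K => [|Q K IH] gK ls cls ro av.
  by split=> //; split.
have [gK' fQ minQ] := gK; have [fK aQ] := fQ; have [lQ clQ roQ [fiQ unQ reQ]] := aQ.
have [cQ aAQ] := andP lQ; have uQ := chordless_uniq cQ.
split=> //.
have far v : v \in verts Q -> e s.1 v ->
    L < index v (verts Q) /\ index v (verts Q) + L.+1 < size (verts Q).
  move=> vQ ev; apply: end_zoneP => //.
  by have := av Q (mem_head _ _) v vQ ev; rewrite mem_guard => /norP[].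
have avK : {in K, forall Q, {in verts Q, forall v, e s.1 v -> v \notin guard K}}.
  move=> b bK v vb ev; have bQK : b \in Q :: K by rewrite inE bK orbT.
  by have := av b bQK v vb ev; rewrite mem_guard => /norP[_ /norP[]].
have clsK : stem_only K s by move=> b bK; apply: cls; rewrite inE bK orbT.
have /andP[sepQ nQ] := cls Q (mem_head _ _).
case: (boolP (has (touches s.1) K)) => [tK|/hasPn ntK].
  have [|_ [_ _ _ [fiK unK reK]]] := IH gK' ls clsK _ avK.
    by rewrite /rooted tK orbT.
  have ntQ : ~~ touches s.1 Q.
    apply/negP => tQ.
    have [s1 [w [s2 [EQ ew n2]]]] := last_split tQ.
    have wQ : w \in verts Q by rewrite EQ mem_cat mem_head orbT.
    have [lw _] := far w wQ ew; rewrite EQ index_split -?EQ // in lw.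
    case: s1 EQ lw => // q1 s1 [_ EQ2] lw; have EQ : verts Q = (Q.1 :: s1) ++ w :: s2.
      by rewrite /verts EQ2.
    have s2Q2 : {subset w :: s2 <= Q.2} by move=> x xs; rewrite EQ2 mem_cat xs orbT.
    have fQ' : forest ((s.1, w :: s2) :: K).
      split=> //; have [_ aK] := IH gK' ls clsK (introT orP (or_intror tK)) avK.
      apply: attachable_restem aK _ _ _ _ => //.
      - rewrite /is_leg chordless_cons2 ew /=; apply/andP; split; last first.
          by move: aAQ; rewrite EQ2 last_cat.
        apply/andP; split.
          apply/allP => x xs; rewrite /apart /= n2 // andbT.
          by apply: contraNneq nQ => ->; rewrite inE s2Q2 ?inE ?xs ?orbT.
        by move: cQ; rewrite EQ => /chordless_catr.
      - by move=> b bK; have /andP[sb _] := clQ b bK; exact: separatedS sb.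
      by rewrite /rooted tK orbT.
    have := minQ _ fQ'; rewrite leqNgt EQ2 size_cat /=.
    by move: lw L3; rewrite /=; clear; lia.
  split=> //; split.
  - by move=> b; rewrite inE => /predU1P[->|bK]; [rewrite (negbTE ntQ) | apply: fiK].
  - move=> b c; rewrite !inE => /predU1P[->|bK]; first by rewrite (negbTE ntQ).
    move=> /predU1P[->|cK] tb; first by rewrite (negbTE ntQ).
    by move=> tc; apply: unK.
  move=> b c; rewrite !inE => /predU1P[->|bK]; first by rewrite (negbTE ntQ).
  move=> /predU1P[->|cK] cb tb tc; last exact: reK.
  move=> v w vb wb ev ew.
  have := av b _ v vb ev; rewrite inE bK orbT => /(_ isT).
  rewrite mem_guard => /norP[_ /norP[+ _]]; rewrite /attachment_zone.
  have : b \in [seq Q' <- K | touches Q.1 Q'] by rewrite mem_filter tc.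
  case EK: [seq Q' <- K | touches Q.1 Q'] => [|b' K'] // _.
  have /andP[tb' bK'] : touches Q.1 b' && (b' \in K).
    by rewrite -(mem_filter (touches Q.1)) EK mem_head.
  rewrite (unQ b' b bK' bK tb' tc) mem_filter vb andbT => /hasPn/(_ w wb).
  by rewrite ew /=; clear; lia.
split=> //; split.
- move=> b; rewrite inE => /predU1P[->|/ntK/negbTE-> //] _; split.
    move=> v vQ ev; have [h1 h2] := far v vQ ev.
    by split; [exact: ltnW | move: h2; clear; lia].
  apply: (greedy_no_shortcut gK) => // [b' bK|v vQ /far[] //].
  apply/separatedP => x y; rewrite inE => /eqP-> yb.
  have sb := untouched_separated (cls b' _) (ntK b' bK).
  by apply: (separatedP _ _ (sb _)); rewrite ?mem_head // inE bK orbT.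
- move=> b c; rewrite !inE => /predU1P[->|/ntK/negbTE-> //] /predU1P[->|/ntK/negbTE-> //] //.
move=> b c; rewrite !inE => /predU1P[->|/ntK/negbTE-> //] /predU1P[->|cK].
  by rewrite eqxx.
by rewrite (negbTE (older_untouched fQ cK)).
Qed.

(** A leg could have stopped at any vertex of [A] beyond its first [L] ones, so
its only vertices in [A] are near its ends. *)
Lemma ends_in_guard K b v : greedy K -> b \in K -> v \in verts b -> v \in A ->
  v \in guard K.
Proof.
elim: K b => // Q K IH b [gK [fK aQ] minQ] bK vb vA; rewrite mem_guard.
move: bK; rewrite inE => /predU1P[Eb|bK]; last by rewrite (IH b) ?orbT.
subst b; case: (boolP (v \in end_zone Q)) => //= nv.
have [lo hi] := end_zoneP vb nv.
have [/andP[cQ _] clQ roQ _] := aQ.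
have [s1 [s2 [EQ iv]]] := index_split_mem vb; rewrite iv in lo hi.
case: s1 EQ lo hi {iv} => // q s1 EQ lo hi; move: (EQ) => [qE EQ2]; subst q.
have fQ' : forest ((Q.1, rcons s1 v) :: K).
  split=> //; apply: attachable_restem aQ _ _ _ _ => //.
  - rewrite /is_leg /= last_rcons vA andbT.
    by move: cQ; rewrite EQ -cat_rcons => /chordless_catl.
  - move=> d dK; have /andP[sd _] := clQ d dK.
    by apply: separatedS sd => // x xs; rewrite EQ2 -cat_rcons mem_cat xs.
  move: roQ; rewrite /rooted /= => /orP[/andP[-> _]|->]; rewrite ?orbT //.
  by rewrite size_rcons; move: lo lL; clear; rewrite /=; lia.
have := minQ _ fQ'; rewrite leqNgt EQ2 size_cat size_rcons /=.
by move: hi; rewrite EQ size_cat /=; clear; lia.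
Qed.

Lemma near_guard K x : forest K -> x \in guard K ->
  exists2 b, b \in K & dist_le e L b.1 x \/ dist_le e L (last b.1 b.2) x.
Proof.
elim: K => // b K IH fb; have [fK [lb _ _ [fi _ _]]] := fb.
have /andP[cb _] := lb; have ub := chordless_uniq cb.
rewrite mem_guard => /or3P[|xa|/(IH fK) [d dK h]]; last 2 first.
- exists b; [exact: mem_head | left].
  move: xa; rewrite /attachment_zone.
  case EK: [seq Q <- K | touches b.1 Q] => [|Q K'] //.
  have /andP[tQ QK] : touches b.1 Q && (Q \in K).
    by rewrite -(mem_filter (touches b.1)) EK mem_head.
  rewrite mem_filter => /andP[/hasP[v vQ /and3P[ev h1 h2]] xQ].
  have /andP[cQ _] := forest_leg fK QK.
  have EL : L = 1 + L.-1 by rewrite add1n prednK // -(subnKC L3).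
  rewrite EL; apply: dist_le_trans (dist_le_edge ev) _.
  case: (leqP (index v (verts Q)) (index x (verts Q))) => vx.
    by apply: path_dist_le cQ vQ xQ _; rewrite vx; move: h2; clear -L3; lia.
  apply: dist_le_sym; apply: path_dist_le cQ xQ vQ _.
  by rewrite (ltnW vx); move: h1; clear -L3; lia.
- by exists d => //; rewrite inE dK orbT.
rewrite /end_zone mem_cat => /orP[xt|xd]; exists b; try exact: mem_head.
  left; have xb := mem_take xt; rewrite in_take // in xt.
  by apply: path_dist_le cb (mem_head _ _) xb _; rewrite /= eqxx -ltnS.
right; have xb := mem_drop xd; apply: dist_le_sym.
have lb' : last b.1 b.2 \in verts b by exact: mem_last.
apply: (path_dist_le cb xb lb'); rewrite index_last //.
have : x \notin take (size (verts b) - L.+1) (verts b).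
  move: ub; rewrite -{1}(cat_take_drop (size (verts b) - L.+1) (verts b)) cat_uniq.
  by move=> /and3P[_ /hasPn h _]; apply: h.
move=> nx; have h : size (verts b) - L.+1 <= index x (verts b).
  by rewrite leqNgt -in_take.
move: (xb); rewrite -index_mem.
by move: h; rewrite /verts /=; clear; lia.
Qed.

Lemma mem_window (s : seq T) m n x : x \in s -> m <= index x s < m + n ->
  x \in take n (drop m s).
Proof.
move=> xs /andP[lo hi].
have sx := xs; rewrite -index_mem in sx.
have -> : x = nth x (take n (drop m s)) (index x s - m).
  rewrite nth_take; last by move: lo hi; clear; lia.
  by rewrite nth_drop subnKC // nth_index.
apply: mem_nth; rewrite size_take size_drop.
by case: ifP => _; move: lo hi sx; clear; lia.
Qed.

(** All neighbours of [q] are within 2 of any one of them, [v0], so the zone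
extends at most [L + 1] vertices to either side of [v0]. *)
Lemma size_junction_zone Q q : chordless (verts Q) -> fits_on Q q ->
  size (junction_zone Q q) <= 2 * L + 3.
Proof.
move=> /chordless_uniq uQ [far short].
case EJ: (junction_zone Q q) => [|w0 J] //; rewrite -{}EJ.
case: (boolP (has (e q) (verts Q))) => [/hasP[v0 v0Q ev0]|/hasPn nt]; last first.
  rewrite /junction_zone (eq_filter (a2 := pred0)) ?filter_pred0 // => w.
  by apply/negP => /hasP[v /nt /negbTE ev /and3P[]]; rewrite ev.
set win := take (2 * L + 3) (drop (index v0 (verts Q) - L.+1) (verts Q)).
apply: (@leq_trans (size win)).
  apply: uniq_leq_size; first exact: filter_uniq.
  move=> w; rewrite mem_filter => /andP[/hasP[v vQ /and3P[ev h1 h2]] wQ].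
  apply: mem_window => //.
  have := short v v0 vQ v0Q ev ev0; have := short v0 v v0Q vQ ev0 ev.
  by move: h1 h2; clear; lia.
by rewrite /win size_take_min geq_minl.
Qed.

(** Each leg contributes at most [2 (L + 1)] vertices at its ends and [2 L + 3]
around its junction. *)
Lemma size_guard K : forest K -> size (guard K) <= (6 * L + 9) * size K.
Proof.
elim: K => // b K IH [fK [_ _ _ [fi _ _]]].
have h1 : size (end_zone b) <= 2 * L.+1.
  by rewrite size_cat size_drop size_take_min; clear; lia.
have h2 : size (attachment_zone K b) <= 2 * L + 3.
  rewrite /attachment_zone; case EK: [seq Q <- K | touches b.1 Q] => [|Q K'] //.
  have /andP[tQ QK] : touches b.1 Q && (Q \in K).
    by rewrite -(mem_filter (touches b.1)) EK mem_head.
  by apply: size_junction_zone; [case/andP: (forest_leg fK QK) | apply: fi].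
have -> : size (guard (b :: K)) =
    size (end_zone b) + size (attachment_zone K b) + size (guard K).
  by rewrite -addnA -!size_cat.
rewrite mulnS; apply: leq_add (IH fK).
by apply: leq_trans (leq_add h1 h2) _; clear; lia.
Qed.

(** If [P] stays away from the guard, then its segment up to the first vertex
[q] in or next to the forest, read from [q] back to the end of [P], is a
further leg; if there is no such [q], then [P] itself is one.  The vertex [q]
can be in the forest only if [P] starts there, which [ends_in_guard] rules
out. *)
Lemma maximal_guarded K P : greedy K -> (forall b, ~ forest (b :: K)) -> good P ->
  exists2 x, x \in P & exists2 g, g \in guard K & (x == g) || e g x.
Proof.
move=> gK stuck [cP endP sP].
suff : has (fun x => has (fun g => (x == g) || e g x) (guard K)) P.
  by case/hasP => x xP /hasP[g gg h]; exists x => //; exists g.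
apply/negPn/negP => /hasPn free0.
have freeA x : x \in P -> x \notin guard K.
  by move=> /free0 /hasPn h; apply/negP => /h; rewrite eqxx.
have free x g : x \in P -> g \in guard K -> ~~ e x g.
  by move=> /free0 /hasPn h /h; rewrite negb_or e_sym => /andP[].
case: (boolP (has (fun x => ~~ all (apart x) (cover K)) P)) => [hit|/hasPn miss].
  have [P1 [q [P2 [EP nq n1]]]] := first_split hit.
  have qP : q \in P by rewrite EP mem_cat mem_head orbT.
  have P1P : {subset P1 <= P} by move=> x xs; rewrite EP mem_cat xs.
  have out x y : x \in P1 -> y \in cover K -> apart x y.
    by move=> /n1 /negPn /allP; apply.
  have nqK : q \notin cover K.
    apply/negP => qK; case/lastP: P1 EP n1 P1P out => [|P1 x] EP n1 P1P out.
      have qA : q \in A by move: endP; rewrite EP /= => /andP[].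
      case/coverP: qK => b bK qb.
      by have := freeA q qP; rewrite (ends_in_guard gK bK qb qA).
    move: cP; rewrite EP chordless_cat => /and5P[_ _ exq _ _].
    by have := out x q; rewrite mem_rcons mem_head /apart /= exq andbF => /(_ isT qK).
  apply: (stuck (q, rev P1)); apply: forest_extend => //.
  - have Es : verts (q, rev P1) = rev (rcons P1 q) by rewrite rev_rcons.
    rewrite /is_leg Es chordless_rev; apply/andP; split.
      by move: cP; rewrite EP -cat_rcons => /chordless_catl.
    case: P1 EP {n1 P1P out Es} => [|a P1] EP.
      by move: endP; rewrite EP /= => /andP[].
    by rewrite rev_cons last_rcons; move: endP; rewrite EP /= => /andP[].
  - move=> b bK /=; apply/andP; split.
      apply/separatedP => x y; rewrite mem_rev => x1 yb; apply: out => //.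
      by apply/coverP; exists b.
    by apply: contraNN nqK => qb; apply/coverP; exists b.
  - rewrite /rooted /=; apply/orP; right.
    case/allPn: nq => y /coverP[b bK yb]; rewrite /apart /= negb_and.
    move=> /orP[/negPn/eqP qy|/negPn eqy].
      by case/negP: nqK; apply/coverP; exists b; rewrite // qy.
    by apply/hasP; exists b => //; apply/touchesP; exists y.
  move=> b bK v vb ev; apply/negP => /(free q _ qP); by rewrite ev.
case: P cP endP sP {free0} freeA free miss => // x p cP /andP[xA lA] sP freeA free miss.
have out y z b : y \in x :: p -> b \in K -> z \in verts b -> apart y z.
  by move=> /miss /negPn /allP h bK zb; apply: h; apply/coverP; exists b.
apply: (stuck (x, p)); apply: forest_extend => //.
- by rewrite /is_leg cP.
- move=> b bK /=; apply/andP; split.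
    by apply/separatedP => y z yp zb; apply: out bK zb; rewrite inE yp orbT.
  by apply/negP => xb; have := out x x b (mem_head _ _) bK xb; rewrite /apart /= eqxx.
- by rewrite /rooted xA /= -ltnS sP.
move=> b bK v vb /= ev; have := out x v b (mem_head _ _) bK vb.
by rewrite /apart /= ev andbF.
Qed.

(** * Conclusion *)

Lemma greedy_or_maximal m : exists K,
  [/\ greedy K, size K <= m & size K = m \/ forall b, ~ forest (b :: K)].
Proof.
elim: m => [|m [K [gK sK [Em|stuck]]]]; first by exists [::]; split=> //; left.
  case: (classic (exists b, forest (b :: K))) => [[b fb]|none]; last first.
    by exists K; split=> //; [rewrite leqW | right=> b fb; apply: none; exists b].
  have [b' [fb' minb]] : exists b', forest (b' :: K) /\
      forall d, forest (d :: K) -> size b'.2 <= size d.2.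
    have [n] := ubnP (size b.2); elim: n b fb => // n IH b fb; rewrite ltnS => sb.
    case: (classic (exists2 d, forest (d :: K) & size d.2 < size b.2)) => [[d fd sd]|no].
      by apply: (IH d fd); apply: leq_trans sb.
    exists b; split=> // d fd; rewrite leqNgt; apply/negP => sd.
    by apply: no; exists d.
  by exists (b' :: K); split=> //=; rewrite ?Em //; left.
by exists K; split=> //; [rewrite leqW | right].
Qed.

End Forest.
End Chordless.

Theorem theorem5 (k l : nat) (hk : 0 < k) (hl : 0 < l)
    (T : finType) (e : rel T) (e_sym : symmetric e) (e_irr : irreflexive e)
    (A : {set T}) :
  (exists P : 'I_k -> seq T,
     (forall i, induced_Apath e A (P i) /\ l <= path_length (P i)) /\
     (forall i j, i != j ->
        anticomplete e [set x in P i] [set x in P j]))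
  \/
  (exists Z1 Z2 : {set T},
     [/\ #|Z1| <= (12 * maxn l 3 + 18) * (k - 1),
         #|Z2| <= 4 * (k - 1),
         ~ (exists s : seq T,
              induced_Apath_minus e A (closed_nbhd e Z1) s /\
              l <= path_length s)
       & ~ (exists s : seq T,
              induced_Apath_minus e A (ball e Z2 (maxn l.+1 4)) s /\
              l <= path_length s)]).
Proof.
set L := maxn l 3.
have lL : l <= L by exact: leq_maxl.
have L3 : 2 < L by exact: leq_maxr.
have EL : maxn l.+1 4 = L.+1 by rewrite maxnSS.
have good_path s : induced_Apath e A s -> l <= path_length s -> good e A l s.
  case=> [[_ _ endA] /(induced_pathP e_sym e_irr)[s0 cs]] ls; split=> //.
  by move: ls; rewrite /path_length; case: s s0 {cs endA}.
have path_good s : good e A l s -> induced_Apath e A s /\ l <= path_length s.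
  case=> cs endA ls; have s0 : s != [::] by case: s ls {cs endA}.
  have ip : induced_path e s by apply/(induced_pathP e_sym e_irr).
  have ll : l <= path_length s by rewrite /path_length; case: s ls {cs endA s0 ip}.
  by split=> //; split=> //; split=> //; [case: ip | apply: leq_trans ll].
have [K [gK sK size_or_max]] := greedy_or_maximal e A l L (2 * k - 1).
have fK := greedy_forest gK.
have [eK|nK] := eqVneq (size K) (2 * k - 1).
  left; have [Ps [sPs pw gPs _]] := forest_packing e_sym e_irr lL L3 fK.
  have kPs : k <= size Ps.
    by apply: leq_trans sPs; rewrite eK; move: hk; clear; lia.
  have Pin (i : 'I_k) : nth [::] Ps i \in Ps.
    by apply: mem_nth; apply: leq_trans kPs.
  exists (fun i => nth [::] Ps i); split=> [i|i j]; first exact/path_good/gPs.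
  (* [pairwise] compares entries in order only; anti-completeness is symmetric. *)
  wlog ij : i j / i < j => [hw ne|_].
    case: (ltngtP i j) => [ij|ji|/val_inj ij]; first exact: hw.
      have [dis no] := hw j i ji (contra_neq esym ne); split.
        by rewrite disjoint_sym.
      by move=> u v ui vj; rewrite e_sym; apply: no.
    by rewrite ij eqxx in ne.
  have /separatedP sep : separated e (nth [::] Ps i) (nth [::] Ps j).
    by apply: (pairwiseP [::] pw) => //; exact: leq_trans (ltn_ord _) kPs.
  split.
    rewrite disjoint_subset; apply/subsetP => u; rewrite !inE => ui.
    by apply/negP => uj; have := sep u u ui uj; rewrite /apart /= eqxx.
  move=> u v; rewrite !inE => ui vj; by have /andP[] := sep u v ui vj.
have stuck : forall b, ~ forest e A l L (b :: K).
  by case: size_or_max => // E; rewrite E eqxx in nK.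
have sK2 : size K <= 2 * (k - 1).
  have: size K < 2 * k - 1 by rewrite ltn_neqAle nK sK.
  by rewrite mulnBr; move: (size K) hk => n; clear; lia.
have hit s : induced_Apath e A s -> l <= path_length s ->
    exists2 x, x \in s & exists2 g, g \in guard e L K & dist_le e 1 g x.
  move=> sA ls; have gs := good_path s sA ls.
  have [x xs [g gg near]] := maximal_guarded e_sym e_irr lL L3 gK stuck gs.
  exists x => //; exists g => //.
  case/orP: near => [/eqP ->|egx]; last exact: dist_le_edge.
  by apply/dist_leP; exists [::].
right; exists [set x in guard e L K].
exists [set x in map fst K ++ map (fun b => last b.1 b.2) K].
have cset (s : seq T) : #|[set x in s]| <= size s by rewrite cardsE; exact: card_size.
split.
- apply: leq_trans (cset _) _; apply: leq_trans (size_guard e_irr fK) _.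
  have -> : (12 * L + 18) * (k - 1) = (6 * L + 9) * (2 * (k - 1)) by clear; lia.
  by rewrite leq_mul2l sK2 orbT.
- apply: leq_trans (cset _) _; rewrite size_cat !size_map.
  by rewrite addnn -mul2n -[4]/(2 * 2) -mulnA leq_mul2l.
- case=> s [[sA avoid] ls]; have [x xs [g gg dgx]] := hit s sA ls.
  have := avoid x xs; rewrite inE; case/negP; apply/existsP; exists g.
  by rewrite inE gg.
case=> s [[sA avoid] ls]; have [x xs [g gg dgx]] := hit s sA ls.
have := avoid x xs; rewrite inE; case/negP; apply/existsP; rewrite EL -addn1.
have [b bK [h|h]] := near_guard e_sym e_irr L3 fK gg.
  by exists b.1; rewrite inE mem_cat map_f //=; exact: dist_le_trans h dgx.
exists (last b.1 b.2); rewrite inE mem_cat (map_f (fun b => last b.1 b.2)) // orbT.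
exact: dist_le_trans h dgx.
Qed.
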